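(* Every intuitionistic structure for a countable signature can be elementarily embedded in an $\omega$-saturated intuitionistic structure (for the same signature).
   Context: **Language.** A signature $(\mathrm{Cnst},\mathrm{Pred})$ consists of disjoint sets of constant symbols and predicate symbols (with arities), without function symbols. Fix a denumerable set $\mathrm{Var}$ of variables. Terms are elements of $\mathrm{Var}\cup\mathrm{Cnst}$. $\mathcal L$ is generated by $\varphi::=P(t_1,\dots,t_n)\mid\bot\mid\varphi\wedge\varphi\mid\varphi\vee\varphi\mid\varphi\to\varphi\mid\forall x\,\varphi\mid\exists x\,\varphi$ (no equality). **Intuitionistic structures.** An intuitionistic structure is $\mathfrak M=(W,\le,\{\mathfrak C_w\}_{w\in W})$ with $(W,\le)$ a poset and, for each $w$, $\mathfrak C_w=(D_w,I_w)$ a classical structure for a signature $(\mathrm{Cnst}_w,\mathrm{Pred})$ with $\mathrm{Cnst}_w\subseteq\mathrm{Cnst}$ ($D_w$ nonempty, $I_w(c)\in D_w$ for $c\in\mathrm{Cnst}_w$, $I_w(P)\subseteq D_w^n$ for $n$-ary $P$), such that (1) $w\le w'$ implies $D_w\subseteq D_{w'}$ and $I_w(P)\subseteq I_{w'}(P)$ for all $P$; (2) for each $c\in\mathrm{Cnst}$ there is $c^{\mathfrak M}\in\bigcup_wD_w$ such that for each $w$: if $c^{\mathfrak M}\in D_w$ then $c\in\mathrm{Cnst}_w$ and $I_w(c)=c^{\mathfrak M}$; otherwise $c\notin\mathrm{Cnst}_w$ and $I_w(c)$ is undefined. Put $D_{\mathfrak M}=\bigcup_wD_w$. An assignment is a map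 $\rho:\mathrm{Var}\to D_{\mathfrak M}$, extended to $\rho^{\mathfrak M}$ on terms by $\rho^{\mathfrak M}(c)=c^{\mathfrak M}$; $\rho[x:=d]$ sends $x$ to $d$ and agrees with $\rho$ elsewhere. Satisfaction $\mathfrak M,w\Vdash^\rho\varphi$: $P(t_1,\dots,t_n)$ iff $(\rho^{\mathfrak M}(t_1),\dots,\rho^{\mathfrak M}(t_n))\in I_w(P)$; $\bot$ never; $\wedge,\vee$ pointwise at $w$; $\varphi\to\psi$ iff for all $w'\ge w$, $\mathfrak M,w'\Vdash^\rho\varphi$ implies $\mathfrak M,w'\Vdash^\rho\psi$; $\forall x\,\varphi$ iff for all $w'\ge w$ and $d\in D_{w'}$, $\mathfrak M,w'\Vdash^{\rho[x:=d]}\varphi$; $\exists x\,\varphi$ iff there is $d\in D_w$ with $\mathfrak M,w\Vdash^{\rho[x:=d]}\varphi$. **Elementary embedding.** An elementary embedding of $\mathfrak M$ into $\mathfrak M'$ is a pair $(\epsilon,\eta)$ of injective functions $\epsilon:W\to W'$ and $\eta:D_{\mathfrak M}\to D_{\mathfrak M'}$ such that for every $\varphi\in\mathcal L$, $w\in W$ and assignment $\rho$ for $\mathfrak M$: $\mathfrak M,w\Vdash^\rho\varphi$ iff $\mathfrak M',\epsilon(w)\Vdash^{\eta\circ\rho}\varphi$. **Separation.** A consecution is a pair $\langle\Gamma:\Delta\rangle$ of sets of formulas. A world $w$ and assignment $\rho$ separate it if $\mathfrak M,w\Vdash^\rho\gamma$ for all $\gamma\in\Gamma$ and $\mathfrak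 M,w\not\Vdash^\rho\delta$ for all $\delta\in\Delta$. It is separable in $U\subseteq W$ if some $w\in U$ and some assignment $\rho$ for $\mathfrak M$ separate it; it is finitely separable in $U$ if $\langle\Gamma':\Delta'\rangle$ is separable in $U$ for all finite $\Gamma'\subseteq\Gamma$, $\Delta'\subseteq\Delta$. A set $\Gamma$ is (finitely) satisfiable in $U$ if $\langle\Gamma:\emptyset\rangle$ is (finitely) separable in $U$. **$\omega$-saturation.** For $A\subseteq D_{\mathfrak M}$, $\mathcal L_A$ is the extension of $\mathcal L$ with new constants $\{\underline a\mid a\in A\}$; formulas of $\mathcal L_A$ are evaluated in the expansion of $\mathfrak M$ interpreting each $\underline a$ as $a$. A set $U\subseteq W$ is positively $\omega$-saturated if for all finite $A\subseteq\bigcap_{w\in U}D_w$ and every set $\Gamma(x)\subseteq\mathcal L_A$ of formulas with (at most) the one free variable $x$, if $\Gamma(x)$ is finitely satisfiable in $U$ then it is satisfiable in $U$. $U$ is $\omega$-saturated if for all finite $A\subseteq\bigcap_{w\in U}D_w$ and all sets $\Gamma(x),\Delta(x)\subseteq\mathcal L_A$ of formulas with (at most) the one free variable $x$, if $\langle\Gamma(x):\Delta(x)\rangle$ is finitely separable in $U$ then it is separable in $U$. The structure $\mathfrak M$ is $\omega$-saturated if for every $w\in W$ the set $\{w\}$ is positively $\omega$-saturated and ${\uparrow}w=\{v\in W\mid w\le v\}$ is $\omega$-saturated. *)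

(* Defs.v *)
From mathcomp Require Import all_boot.
From mathcomp Require Import boolp classical_sets functions cardinality.

Set Implicit Arguments.
Unset Strict Implicit.
Unset Printing Implicit Defensive.

Local Open Scope classical_set_scope.

Record signature := Signature {
  Cnst : Type;
  Pred : Type;
  arity : Pred -> nat
}.

Definition countable_signature (S : signature) : Prop :=
  countable [set: Cnst S] /\ countable [set: Pred S].

Section Language.
Context (S : signature).

(* The denumerable set of variables is [nat]. *)
Inductive term : Type :=
| TVar of nat
| TCnst of Cnst S.

Inductive form : Type :=
| FAtom (P : Pred S) of (arity P).-tuple term
| FBot
| FAnd of form & form
| FOr of form & form
| FImp of form & form
| FAll of nat & form
| FEx of nat & form.

Fixpoint free_vars (phi : form) : set nat :=
  match phi with
  | FAtom P ts => [set x | exists i, tnth ts i = TVar x]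
  | FBot => set0
  | FAnd a b | FOr a b | FImp a b => free_vars a `|` free_vars b
  | FAll x a | FEx x a => free_vars a `\ x
  end.

(* A classical structure whose domain is a subset of an ambient type [D].
   [cs_cnst] is a partial function: the constants of the structure's own
   signature are those [c] with [cs_cnst c <> None]. *)
Record cstruct (D : Type) := CStruct {
  cs_dom : set D;
  cs_cnst : Cnst S -> option D;
  cs_pred : forall P : Pred S, set ((arity P).-tuple D);
  cs_dom_nonempty : cs_dom !=set0;
  cs_cnst_dom : forall c d, cs_cnst c = Some d -> cs_dom d;
  cs_pred_dom : forall P t, @cs_pred P t -> forall i, cs_dom (tnth t i)
}.

(* [Dom] is the union of the domains of the worlds (see [cover]). Since
   [cnst c] lies in some world's domain, [cnst_spec] determines it uniquely,
   so having it as a field adds no data to the structure. *)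
Record istruct := IStruct {
  World : Type;
  le : World -> World -> Prop;
  Dom : Type;
  str : World -> cstruct Dom;
  cnst : Cnst S -> Dom;
  le_refl : forall w, le w w;
  le_trans : forall u v w, le u v -> le v w -> le u w;
  le_antisym : forall v w, le v w -> le w v -> v = w;
  cover : forall d, exists w, cs_dom (str w) d;
  dom_mono : forall v w, le v w -> cs_dom (str v) `<=` cs_dom (str w);
  pred_mono : forall v w, le v w ->
    forall P, @cs_pred _ (str v) P `<=` @cs_pred _ (str w) P;
  cnst_spec : forall c w,
    (cs_dom (str w) (cnst c) -> cs_cnst (str w) c = Some (cnst c)) /\
    (~ cs_dom (str w) (cnst c) -> cs_cnst (str w) c = None)
}.

Definition assignment (M : istruct) := nat -> Dom M.

Definition update (M : istruct) (rho : assignment M) (x : nat) (d : Dom M) :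
  assignment M := fun y => if y == x then d else rho y.

Definition eval_term (M : istruct) (rho : assignment M) (t : term) : Dom M :=
  match t with TVar x => rho x | TCnst c => cnst M c end.

Fixpoint sat (M : istruct) (w : World M) (rho : assignment M) (phi : form) :
  Prop :=
  match phi with
  | FAtom P ts => cs_pred (str w) (map_tuple (eval_term rho) ts)
  | FBot => False
  | FAnd a b => sat w rho a /\ sat w rho b
  | FOr a b => sat w rho a \/ sat w rho b
  | FImp a b => forall w', le w w' -> sat w' rho a -> sat w' rho b
  | FAll x a => forall w', le w w' -> forall d, cs_dom (str w') d ->
      sat w' (update rho x d) a
  | FEx x a => exists2 d, cs_dom (str w) d & sat w (update rho x d) a
  end.

Definition elementary_embedding (M M' : istruct)
    (eps : World M -> World M') (eta : Dom M -> Dom M') : Prop :=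
  [/\ injective eps,
      injective eta &
      forall (phi : form) (w : World M) (rho : assignment M),
        sat w rho phi <-> @sat M' (eps w) (eta \o rho) phi].

Definition separates (M : istruct) (w : World M) (rho : assignment M)
    (Gamma Delta : set form) : Prop :=
  (forall gamma, Gamma gamma -> sat w rho gamma) /\
  (forall delta, Delta delta -> ~ sat w rho delta).

Definition separable (M : istruct) (U : set (World M))
    (Gamma Delta : set form) : Prop :=
  exists2 w, U w & exists rho : assignment M, separates w rho Gamma Delta.

Definition finitely_separable (M : istruct) (U : set (World M))
    (Gamma Delta : set form) : Prop :=
  forall Gamma' Delta' : set form,
    finite_set Gamma' -> Gamma' `<=` Gamma ->
    finite_set Delta' -> Delta' `<=` Delta ->
    separable U Gamma' Delta'.

Definition satisfiable (M : istruct) (U : set (World M)) (Gamma : set form) :=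
  separable U Gamma set0.

Definition finitely_satisfiable (M : istruct) (U : set (World M))
    (Gamma : set form) :=
  finitely_separable U Gamma set0.

End Language.

Definition ext_signature (S : signature) (D : Type) (A : set D) : signature :=
  {| Cnst := (Cnst S + A)%type; Pred := Pred S; arity := @arity S |}.

Section Expansion.
Context (S : signature) (M : istruct S) (A : set (Dom M)).
Let SA := ext_signature S A.

Definition exp_cnst (c : Cnst SA) : Dom M :=
  match c with inl c => cnst M c | inr a => val a end.

(* The constant naming [a] is interpreted exactly at the worlds whose domain
   contains [a]. *)
Definition exp_cs_cnst (w : World M) (c : Cnst SA) : option (Dom M) :=
  match c with
  | inl c => cs_cnst (str w) c
  | inr a => if val a \in cs_dom (str w) then Some (val a) else None
  end.

Lemma exp_cs_cnst_dom w c d : exp_cs_cnst w c = Some d -> cs_dom (str w) d.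
Proof.
case: c => [c|a] /=; first exact: cs_cnst_dom.
by case: ifPn => // /set_mem ha [<-].
Qed.

Definition exp_str (w : World M) : cstruct SA (Dom M) :=
  @CStruct SA (Dom M) (cs_dom (str w)) (exp_cs_cnst w)
    (@cs_pred S (Dom M) (str w)) (cs_dom_nonempty (str w))
    (@exp_cs_cnst_dom w) (@cs_pred_dom S (Dom M) (str w)).

Lemma exp_cnst_spec c w :
  (cs_dom (exp_str w) (exp_cnst c) ->
     cs_cnst (exp_str w) c = Some (exp_cnst c)) /\
  (~ cs_dom (exp_str w) (exp_cnst c) -> cs_cnst (exp_str w) c = None).
Proof.
case: c => [c|a] /=; first exact: cnst_spec.
by split=> ha; [rewrite mem_set | rewrite memNset].
Qed.

Definition expansion : istruct SA :=
  @IStruct SA (World M) (@le S M) (Dom M) exp_str exp_cnst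
    (@le_refl S M) (@le_trans S M) (@le_antisym S M) (@cover S M)
    (@dom_mono S M) (@pred_mono S M) exp_cnst_spec.

End Expansion.

Section Saturation.
Context (S : signature) (M : istruct S).

Definition common_dom (U : set (World M)) : set (Dom M) :=
  \bigcap_(w in U) cs_dom (str w).

Definition only_free (S' : signature) (x : nat) (Gamma : set (form S')) :=
  forall phi, Gamma phi -> free_vars phi `<=` [set x].

Definition pos_omega_saturated_in (U : set (World M)) : Prop :=
  forall A : set (Dom M), finite_set A -> A `<=` common_dom U ->
  forall (x : nat) (Gamma : set (form (ext_signature S A))),
    only_free x Gamma ->
    finitely_satisfiable (M := expansion A) U Gamma ->
    satisfiable (M := expansion A) U Gamma.

Definition omega_saturated_in (U : set (World M)) : Prop :=
  forall A : set (Dom M), finite_set A -> A `<=` common_dom U ->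
  forall (x : nat) (Gamma Delta : set (form (ext_signature S A))),
    only_free x Gamma -> only_free x Delta ->
    finitely_separable (M := expansion A) U Gamma Delta ->
    separable (M := expansion A) U Gamma Delta.

Definition upset (w : World M) : set (World M) := [set v | le w v].

Definition omega_saturated : Prop :=
  forall w : World M,
    pos_omega_saturated_in [set w] /\ omega_saturated_in (upset w).

End Saturation.

(* Main.v *)
Require Import Defs.
From mathcomp Require Import all_boot.
From mathcomp Require Import boolp classical_sets functions cardinality filter.
Set Implicit Arguments.
Unset Strict Implicit.
Unset Printing Implicit Defensive.
Local Open Scope classical_set_scope.

(** The saturated structure is the ultrapower of [M] along a nonprincipal
    ultrafilter [U] on [nat], and the embedding is the diagonal one.

    An intuitionistic structure is a classical two-sorted structure (worlds and
    individuals, with the order, the domain relation and one relation for each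
    predicate), and forcing is first-order definable in it: an implication or a
    universal formula quantifies over worlds.  Hence a form of the theorem of
    Los holds ([sat_uclass]): a formula is forced in the ultrapower at the
    class of a sequence of worlds exactly when it is forced at [U]-almost all
    terms of the sequence.  Constant sequences give the elementary embedding
    ([diagonal_elementary]).

    Saturation is the usual countable saturation of ultrapowers along an
    ultrafilter that contains all cofinite sets.  If every finite part of a
    countable list of conditions can be met at almost every index, then at
    index [i] one meets as long an initial part, of length at most [i], as is
    possible there; each condition is then met at almost every index
    ([near_diagonal]).  With finitely many parameters over a countable
    signature there are only countably many formulas ([countable_form]), so
    the conditions ``this formula is forced'' and ``this formula is not
    forced'' can be listed.  Such a condition, about a world ranging over an
    upset, or over a singleton, of the ultrapower, can be imposed at each index
    because these two sets of worlds are internal, that is, given by a sequence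
    of sets of worlds of [M] ([internal_omega_saturated]).

    The constants naming parameters belong to a signature that depends on the
    ultrapower, so they make no sense in [M] itself.  They are first traded for
    variables: old variables move to even places, and odd places hold the
    parameters ([sat_tr]).  The theorem of Los then applies to the translated
    formulas. *)

(** * Almost everywhere quantification along an ultrafilter *)

Section UltrafilterQuantifier.
Context (I : Type) (U : set_system I) {UU : UltraFilter U}.

Lemma not_near (P : I -> Prop) :
  ~ (\forall i \near U, P i) -> \forall i \near U, ~ P i.
Proof. by move=> nUP; case: (in_ultra_setVsetC P UU). Qed.

Lemma near_not (P : I -> Prop) :
  (\forall i \near U, ~ P i) -> ~ (\forall i \near U, P i).
Proof.
move=> UnP UP; have /filter_ex[i []//] : \forall i \near U, P i /\ ~ P i.
by apply: filterS2 UP UnP => i.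
Qed.

Lemma near_or (P Q : I -> Prop) :
  (\forall i \near U, P i \/ Q i) <->
  (\forall i \near U, P i) \/ (\forall i \near U, Q i).
Proof.
split=> [UPQ|[]]; [|by apply: filterS => i; left|by apply: filterS => i; right].
have [|/not_near UnP] := pselect (\forall i \near U, P i); first by left.
by right; apply: filterS2 UPQ UnP => i [].
Qed.

(** Skolem functions for the almost everywhere quantifier; [f0] supplies the
    values at the exceptional indices. *)
Lemma near_choice (T : Type) (f0 : I -> T) (R : I -> T -> Prop) :
  (\forall i \near U, exists y, R i y) ->
  exists f : I -> T, \forall i \near U, R i (f i).
Proof.
move=> UR.
have /choice[f Rf] : forall i, exists y, (exists z, R i z) -> R i y.
  move=> i; have [[y Ry]|nR] := pselect (exists z, R i z); first by exists y.
  by exists (f0 i).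
by exists f; apply: filterS UR => i; exact: Rf.
Qed.

End UltrafilterQuantifier.

(** * Ultrapowers of types *)

Section Ultrapower.
Context (I : Type) (U : set_system I) {UU : UltraFilter U} (T : Type).

Definition agree (f g : {classic I -> T}) : bool :=
  `[< \forall i \near U, f i = g i >].

Lemma agree_refl : reflexive agree.
Proof. by move=> f; apply/asboolP; apply: nearW. Qed.

Lemma agree_sym : symmetric agree.
Proof.
by move=> f g; apply/asboolP/asboolP; apply: filterS => i.
Qed.

Lemma agree_trans : transitive agree.
Proof.
move=> g f h /asboolP fg /asboolP gh; apply/asboolP.
by apply: filterS2 fg gh => i ->.
Qed.

Canonical agree_equiv := EquivRel agree agree_refl agree_sym agree_trans.

Definition ultrapower : Type := {eq_quot agree}%qT.

Definition uclass (f : I -> T) : ultrapower := (\pi_({eq_quot agree}) f)%qT.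

Definition urepr (x : ultrapower) : I -> T := repr (x : {eq_quot agree}%qT).

Lemma ureprK x : uclass (urepr x) = x.
Proof. exact: reprK. Qed.

Lemma uclassP f g : uclass f = uclass g <-> \forall i \near U, f i = g i.
Proof. by split=> [/eqmodP/asboolP|fg]; last exact/eqmodP/asboolP. Qed.

Lemma urepr_uclass f : \forall i \near U, urepr (uclass f) i = f i.
Proof. by apply/uclassP; rewrite ureprK. Qed.

End Ultrapower.

Arguments ultrapower {I} U {UU} T.
Arguments uclass {I} U {UU} {T} f.
Arguments urepr_uclass {I} U {UU} {T} f.

(** * The ultrapower of an intuitionistic structure *)

Section UltrapowerStructure.
Context (S : signature) (M : istruct S).
Context (I : Type) (U : set_system I) {UU : UltraFilter U}.

Local Notation W := (ultrapower U (World M)).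
Local Notation D := (ultrapower U (Dom M)).

Definition ule (v w : W) : Prop :=
  \forall i \near U, le (urepr v i) (urepr w i).

Definition udom (w : W) : set D :=
  [set d | \forall i \near U, cs_dom (str (urepr w i)) (urepr d i)].

Definition ucnst (c : Cnst S) : D := uclass U (fun=> cnst M c).

Definition ucs_cnst (w : W) (c : Cnst S) : option D :=
  if `[< udom w (ucnst c) >] then Some (ucnst c) else None.

Definition upred (w : W) (P : Pred S) : set ((arity P).-tuple D) :=
  [set t | \forall i \near U,
    cs_pred (str (urepr w i)) (map_tuple (fun d => urepr d i) t)].

Lemma udom_nonempty w : udom w !=set0.
Proof.
have [d wd] := choice (fun i => cs_dom_nonempty (str (urepr w i))).
by exists (uclass U d); apply: filterS (urepr_uclass U d) => i ->.
Qed.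

Lemma ucs_cnst_dom w c d : ucs_cnst w c = Some d -> udom w d.
Proof. by rewrite /ucs_cnst; case: asboolP => // + [<-]. Qed.

Lemma upred_dom w P t : @upred w P t -> forall j, udom w (tnth t j).
Proof.
by move=> + j; apply: filterS => i /cs_pred_dom/(_ j); rewrite tnth_map.
Qed.

Definition ustr (w : W) : cstruct S D :=
  CStruct (udom_nonempty w) (@ucs_cnst_dom w) (@upred_dom w).

Lemma ule_refl w : ule w w.
Proof. by apply: nearW => i; exact: le_refl. Qed.

Lemma ule_trans u v w : ule u v -> ule v w -> ule u w.
Proof. by apply: filterS2 => i; exact: le_trans. Qed.

Lemma ule_antisym v w : ule v w -> ule w v -> v = w.
Proof.
move=> vw wv; rewrite -[v]ureprK -[w]ureprK; apply/uclassP.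
by apply: filterS2 vw wv => i; exact: le_antisym.
Qed.

(** An individual of the ultrapower is the class of a sequence of individuals of
    [M]; choosing at each index a world containing the individual gives a world
    of the ultrapower. *)
Lemma ucover d : exists w, cs_dom (ustr w) d.
Proof.
have [w wd] := choice (fun i => Defs.cover (urepr d i)).
by exists (uclass U w); apply: filterS (urepr_uclass U w) => i /= ->.
Qed.

Lemma udom_mono v w : ule v w -> udom v `<=` udom w.
Proof. by move=> vw d; apply: filterS2 vw => i /dom_mono; apply. Qed.

Lemma upred_mono v w : ule v w -> forall P, @upred v P `<=` @upred w P.
Proof. by move=> vw P t; apply: filterS2 vw => i /pred_mono; apply. Qed.

Lemma ucnst_spec c w :
  (cs_dom (ustr w) (ucnst c) -> cs_cnst (ustr w) c = Some (ucnst c)) /\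
  (~ cs_dom (ustr w) (ucnst c) -> cs_cnst (ustr w) c = None).
Proof. by rewrite /= /ucs_cnst; split; case: asboolP. Qed.

Definition ustruct : istruct S :=
  IStruct ule_refl ule_trans ule_antisym ucover udom_mono upred_mono
    ucnst_spec.

Lemma ule_uclass (v w : I -> World M) :
  ule (uclass U v) (uclass U w) <-> \forall i \near U, le (v i) (w i).
Proof.
split; apply: filterS3 (urepr_uclass U v) (urepr_uclass U w) => i.
  by move=> -> ->.
by move=> /= -> ->.
Qed.

Lemma udom_uclass (w : I -> World M) (d : I -> Dom M) :
  udom (uclass U w) (uclass U d) <->
  \forall i \near U, cs_dom (str (w i)) (d i).
Proof.
split; apply: filterS3 (urepr_uclass U w) (urepr_uclass U d) => i.
  by move=> -> ->.
by move=> /= -> ->.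
Qed.

Lemma eval_term_uclass (rho : I -> assignment M) (t : term S) :
  @eval_term S ustruct (fun x => uclass U (rho^~ x)) t =
  uclass U (fun i => eval_term (rho i) t).
Proof. by case: t. Qed.

Lemma update_uclass (rho : I -> assignment M) (x : nat) (d : I -> Dom M) :
  @update S ustruct (fun y => uclass U (rho^~ y)) x (uclass U d) =
  fun y => uclass U ((fun i => update (rho i) x (d i))^~ y).
Proof. by apply/funext => y; rewrite /update; case: eqP. Qed.

(** The theorem of Los for forcing, by induction on the formula.  In the cases
    of [FImp] and [FAll], if the formula fails at almost all indices, the
    witnesses of the failures (later worlds and individuals) are collected by
    [near_choice] into a single later world, and individual, of the ultrapower
    where it fails as well. *)
Lemma sat_uclass (phi : form S) (w : I -> World M) (rho : I -> assignment M) :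
  @sat S ustruct (uclass U w) (fun x => uclass U (rho^~ x)) phi <->
  \forall i \near U, sat (w i) (rho i) phi.
Proof.
elim: phi w rho => [P ts||a iha b ihb|a iha b ihb|a iha b ihb|x a iha|x a iha]
  w rho /=.
- (* The terms are finitely many, so almost every index is one where the
     chosen representatives of all their classes agree with them. *)
  have ts_near : \forall i \near U,
      map_tuple (fun d => urepr d i)
        (map_tuple (@eval_term S ustruct (fun x => uclass U (rho^~ x))) ts) =
      map_tuple (eval_term (rho i)) ts.
    have : \forall i \near U, forall j,
        urepr (uclass U (fun i => eval_term (rho i) (tnth ts j))) i =
        eval_term (rho i) (tnth ts j).
      by apply: filter_forall => j; exact: urepr_uclass.
    apply: filterS => i tsi; apply: eq_from_tnth => j.
    by rewrite !tnth_map eval_term_uclass tsi.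
  by split; apply: filterS3 (urepr_uclass U w) ts_near => i /= -> ->.
- by split=> // /filter_ex[].
- by rewrite iha ihb near_andP.
- by rewrite iha ihb near_or.
- split=> [ab|ab w'].
    apply: contrapT => /not_near nab.
    have [|v hv] := @near_choice _ U _ _ w (fun i v =>
      [/\ le (w i) v, sat v (rho i) a & ~ sat v (rho i) b]).
      apply: filterS nab => i; apply: contra_notP => nex v wv va.
      by apply: contrapT => nvb; apply: nex; exists v.
    have /near_not : \forall i \near U, ~ sat (v i) (rho i) b.
      by apply: filterS hv => i [].
    by apply; apply/ihb/ab; [apply/ule_uclass|apply/iha];
      apply: filterS hv => i [].
  rewrite -[w']ureprK ule_uclass iha ihb.
  by apply: filterS3 ab => i ab wv; apply: ab.
- split=> [wa|wa w' ww' d].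
    apply: contrapT => /not_near nwa.
    have [d0 _] := choice (fun i => cs_dom_nonempty (str (w i))).
    have [|p hp] := @near_choice _ U _ _ (fun i => (w i, d0 i)) (fun i p =>
      [/\ le (w i) p.1, cs_dom (str p.1) p.2 &
          ~ sat p.1 (update (rho i) x p.2) a]).
      apply: filterS nwa => i; apply: contra_notP => nex v wv d vd.
      by apply: contrapT => nva; apply: nex; exists (v, d).
    have /near_not : \forall i \near U,
        ~ sat (p i).1 (update (rho i) x (p i).2) a.
      by apply: filterS hp => i [].
    apply; apply/(iha (fst \o p)); rewrite -update_uclass; apply: wa.
      by apply/ule_uclass; apply: filterS hp => i [].
    by apply/udom_uclass; apply: filterS hp => i [].
  move: ww'; rewrite -[w']ureprK -[d]ureprK ule_uclass udom_uclass.
  rewrite update_uclass iha.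
  by apply: filterS3 wa => i wa wv vd; apply: wa.
- split=> [[d]|wa].
    rewrite -[d]ureprK udom_uclass update_uclass iha.
    by apply: filterS2 => i wd wa; exists (urepr d i).
  have [d0 _] := choice (fun i => cs_dom_nonempty (str (w i))).
  have [|d hd] := @near_choice _ U _ _ d0 (fun i d =>
      cs_dom (str (w i)) d /\ sat (w i) (update (rho i) x d) a).
    by apply: filterS wa => i [d wd da]; exists d.
  exists (uclass U d); first by apply/udom_uclass; apply: filterS hd => i [].
  by rewrite update_uclass iha; apply: filterS hd => i [].
Qed.

Lemma diagonal_elementary :
  elementary_embedding (M' := ustruct)
    (fun w => uclass U (fun=> w)) (fun d => uclass U (fun=> d)).
Proof.
have near_const (P : Prop) : (\forall i \near U, P) <-> P.
  by split=> [/filter_ex[]|p] //; exact: nearW.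
split=> [v w /uclassP/near_const|d e /uclassP/near_const|phi w rho] //.
by rewrite -(near_const (sat w rho phi)) -sat_uclass.
Qed.

End UltrapowerStructure.

Arguments ustruct {S} M {I} U {UU}.

(** * Meeting countably many conditions *)

(** The diagonal argument behind countable saturation.  At index [i], [f i]
    meets the conditions of index less than [n] for the largest possible [n <= i].
    For each [n], almost every [i] satisfies [n < i] and allows the first [n.+1]
    conditions to be met, so that [f i] meets condition [n]; this is where [U]
    has to contain the cofinite sets. *)
Lemma near_diagonal (U : set_system nat) {UU : UltraFilter U} (T : Type)
    (f0 : nat -> T) (C : nat -> nat -> T -> Prop) :
  \oo `<=` U ->
  (forall n, \forall i \near U, exists y, forall m, m < n -> C m i y) ->
  exists f : nat -> T, forall n, \forall i \near U, C n i (f i).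
Proof.
move=> ooU UC.
have best N i : exists y, forall n, n <= N ->
    (exists z, forall m, m < n -> C m i z) -> forall m, m < n -> C m i y.
  elim: N => [|N [y ihy]]; first by exists (f0 i) => n; rewrite leqn0 => /eqP->.
  have [[z zC]|nz] := pselect (exists z, forall m, m < N.+1 -> C m i z).
    by exists z => n nN _ m mn; apply: zC; exact: leq_trans mn nN.
  by exists y => n; rewrite leq_eqVlt => /predU1P[-> /nz//|]; exact: ihy.
have [f fC] := choice (fun i => best i i).
exists f => n.
have nU : \forall i \near U, n < i by apply: ooU; exists n.+1.
by apply: filterS2 nU (UC n.+1) => i ni ex; exact: fC ni ex n (ltnSn n).
Qed.

(** * Countability of the language *)

Section FormulaCoding.
Context (S : signature) (fC : Cnst S -> nat) (fP : Pred S -> nat).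

Definition term_code (t : term S) : nat :=
  match t with TVar x => x.*2 | TCnst c => (fC c).*2.+1 end.

Fixpoint form_code (phi : form S) : GenTree.tree nat :=
  match phi with
  | FAtom P ts => GenTree.Node 0
      (GenTree.Leaf (fP P) :: [seq GenTree.Leaf (term_code t) | t <- ts])
  | FBot => GenTree.Node 1 [::]
  | FAnd a b => GenTree.Node 2 [:: form_code a; form_code b]
  | FOr a b => GenTree.Node 3 [:: form_code a; form_code b]
  | FImp a b => GenTree.Node 4 [:: form_code a; form_code b]
  | FAll x a => GenTree.Node 5 [:: GenTree.Leaf x; form_code a]
  | FEx x a => GenTree.Node 6 [:: GenTree.Leaf x; form_code a]
  end.

Lemma term_code_inj : injective fC -> injective term_code.
Proof.
move=> fCI [x|c] [y|d] /= E.
- by rewrite (double_inj E).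
- by have := congr1 odd E; rewrite /= !odd_double.
- by have := congr1 odd E; rewrite /= !odd_double.
- by case: E => /double_inj/fCI ->.
Qed.

Lemma form_code_inj : injective fC -> injective fP -> injective form_code.
Proof.
move=> fCI fPI.
elim=> [P ts||a iha b ihb|a iha b ihb|a iha b ihb|x a iha|x a iha]
  [Q us||a' b'|a' b'|a' b'|y a'|y a'] //=.
- (* The type of [us] depends on [Q], so the equality of predicates must be
     eliminated before the argument lists are compared. *)
  case=> /fPI PQ; case: _ / PQ us => us /inj_map tsus.
  by congr FAtom; apply/val_inj/tsus => t u [/(term_code_inj fCI)].
- by case=> /iha -> /ihb ->.
- by case=> /iha -> /ihb ->.
- by case=> /iha -> /ihb ->.
- by case=> -> /iha ->.
- by case=> -> /iha ->.
Qed.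

End FormulaCoding.

Lemma countable_setTP (T : Type) :
  countable [set: T] <-> exists f : T -> nat, injective f.
Proof.
split=> [/countable_injP[f fI]|[f fI]].
  by exists f => x y; apply: fI; rewrite inE.
by apply/countable_injP; exists f => x y _ _; exact: fI.
Qed.

Lemma countable_form (S : signature) :
  countable_signature S -> countable [set: form S].
Proof.
case=> /countable_setTP[fC fCI] /countable_setTP[fP fPI].
apply/countable_setTP; exists (pickle \o form_code fC fP).
exact: inj_comp (pcan_inj pickleK) (form_code_inj fCI fPI).
Qed.

Lemma countable_ext_signature (S : signature) (D : Type) (A : set D) :
  countable_signature S -> countable A ->
  countable_signature (ext_signature S A).
Proof.
case=> /countable_setTP[fC fCI] cP /countable_injP[fA fAI]; split=> //.
apply/countable_setTP.
exists (fun c => pickle (match c with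
  | inl c => inl (fC c) | inr a => inr (fA (val a)) end : nat + nat)).
move=> c d /(pcan_inj pickleK).
case: c d => [c|a] [d|b] // []; first by move/fCI ->.
by move/fAI => ab; congr inr; apply/val_inj/ab; apply: valP.
Qed.

(** * Parameters as variables *)

Section ParametersAsVariables.
Context (S : signature).

Section Translation.
Context (D : Type) (A : set D) (code : A -> nat).

(** Infinitely many formulas are translated with the same [code], and together
    they may bind every variable; doubling the old variables keeps the odd ones,
    which stand for the parameters, free in all translations. *)
Definition tr_term (t : term (ext_signature S A)) : term S :=
  match t with
  | TVar x => TVar S x.*2
  | TCnst (inl c) => TCnst c
  | TCnst (inr a) => TVar S (code a).*2.+1
  end.

Fixpoint tr (phi : form (ext_signature S A)) : form S :=
  match phi with
  | FAtom P ts => @FAtom S P (map_tuple tr_term ts)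
  | FBot => FBot S
  | FAnd a b => FAnd (tr a) (tr b)
  | FOr a b => FOr (tr a) (tr b)
  | FImp a b => FImp (tr a) (tr b)
  | FAll x a => FAll x.*2 (tr a)
  | FEx x a => FEx x.*2 (tr a)
  end.

End Translation.

Context (M : istruct S).

Definition interleave (rho par : assignment M) : assignment M :=
  fun y => if odd y then par y./2 else rho y./2.

Lemma interleave_update (rho par : assignment M) x d :
  interleave (update rho x d) par = update (interleave rho par) x.*2 d.
Proof.
apply/funext => y; rewrite /interleave /update.
have [->|yx] := eqVneq y x.*2; first by rewrite odd_double doubleK eqxx.
case: ifPn => // ev; case: eqP => // e.
by move: yx; rewrite -e even_halfK ?eqxx.
Qed.

Lemma sat_tr (A : set (Dom M)) (code : A -> nat) (par : assignment M) :
  (forall a : A, par (code a) = val a) ->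
  forall phi (w : World M) (rho : assignment M),
  @sat _ (expansion A) w rho phi <-> sat w (interleave rho par) (tr code phi).
Proof.
move=> parE; elim=> [P ts||a iha b ihb|a iha b ihb|a iha b ihb|x a iha|x a iha]
  w rho //=.
- rewrite (_ : map_tuple _ (map_tuple _ _) =
               map_tuple (@eval_term _ (expansion A) rho) ts) //.
  apply: eq_from_tnth => j; rewrite !tnth_map.
  case: (tnth ts j) => [y|[c|a]] //=; rewrite /interleave /=.
    by rewrite odd_double doubleK.
  by rewrite odd_double /= uphalf_double.
- by rewrite iha ihb.
- by rewrite iha ihb.
- by split=> H v wv; move: (H v wv); rewrite iha ihb.
- by split=> H v wv d vd; move: (H v wv d vd); rewrite -interleave_update iha.
- by split=> -[d wd]; rewrite -?interleave_update ?iha => H; exists d;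
    rewrite // -?interleave_update ?iha.
Qed.

End ParametersAsVariables.

Lemma countable_parameters (D : Type) (A : set D) (d0 : D) :
  countable A ->
  exists (code : A -> nat) (par : nat -> D), forall a : A, par (code a) = val a.
Proof.
move=> /countable_injP[f fI].
have /choice[par parE] : forall k, exists d,
    forall a, a \in A -> f a = k -> d = a.
  move=> k; have [[a [aA fa]]|na] := pselect (exists a, a \in A /\ f a = k).
    by exists a => b bA fb; apply: fI => //; rewrite fa.
  by exists d0 => a aA fa; case: na; exists a.
exists (f \o val), par => a.
by apply: parE => //; apply: valP.
Qed.

(** * Saturation of the ultrapower *)

Section Saturation.
Context (S : signature) (HS : countable_signature S) (M : istruct S).
Context (U : set_system nat) {UU : UltraFilter U} (ooU : \oo `<=` U).

Local Notation M' := (ustruct M U).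

(** What is sought, a world in [B i] and an assignment, is taken at each index
    as one object of type [T], to which [near_diagonal] is applied; the [m]-th
    condition concerns the formula of code [m].  That the first [n] conditions
    can be met at almost every index follows by the theorem of Los from
    separability of the finite part of [G] and [D] made of codes less than
    [n]. *)
Lemma internal_omega_saturated (B : nat -> set (World M)) :
  @omega_saturated_in S M' [set v | \forall i \near U, B i (urepr v i)].
Proof.
move=> A finA _ x G D _ _ GD.
have cA := finite_set_countable finA.
(* Separability of the empty consecution only serves to provide a default
   world and a default assignment. *)
have [||v0 _ [rho0 _]] := GD set0 set0 (finite_set0 _) _ (finite_set0 _) _.
- exact: sub0set.
- exact: sub0set.
have /countable_setTP[c cI] := countable_form (countable_ext_signature HS cA).
have [code [par parE]] := countable_parameters (rho0 0 : Dom M') cA.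
(* The terms at index [i] of sequences representing the parameters. *)
pose upar i : assignment M := fun k => urepr (par k) i.
pose T := (World M * assignment M)%type.
pose decides i (y : T) phi := sat y.1 (interleave y.2 (upar i)) (tr code phi).
have decidesP (f : nat -> T) phi :
    (\forall i \near U, decides i (f i) phi) <->
    @sat _ (expansion A) (uclass U (fst \o f))
      (fun z => uclass U (fun i => (f i).2 z)) phi.
  rewrite (sat_tr parE) -(sat_uclass _ (fst \o f)).
  rewrite (_ : (fun z => _) = interleave (M := M')
    (fun z => uclass U (fun i => (f i).2 z)) par) //.
  apply/funext => z; rewrite /interleave; case: ifP => // _.
  by rewrite -[RHS]ureprK.
pose C m i (y : T) := B i y.1 /\ forall phi, c phi = m ->
  (G phi -> decides i y phi) /\ (D phi -> ~ decides i y phi).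
have finC (E : set (form (ext_signature S A))) n :
    finite_set (E `&` [set phi | c phi < n]).
  apply: finite_setIr.
  rewrite (_ : [set _ | _] = c @^-1` `I_n) //.
  by apply: finite_preimage => // p q _ _; exact: cI.
have [|f fC] := @near_diagonal U _ T
    (fun i => (urepr v0 i, fun z => urepr (rho0 z) i)) C ooU.
  move=> n.
  have [||v Bv [rho [Gv Dv]]] := GD _ _ (finC G n) _ (finC D n) _.
  - exact: subIsetl.
  - exact: subIsetl.
  pose f i : T := (urepr v i, fun z => urepr (rho z) i).
  have fE phi : (\forall i \near U, decides i (f i) phi) <->
      @sat _ (expansion A) v rho phi.
    rewrite decidesP (_ : uclass U (fst \o f) = v) ?ureprK //.
    rewrite (_ : (fun z => _) = rho) //.
    by apply/funext => z; rewrite /f /= ureprK.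
  suff : \forall i \near U, forall m : 'I_n, C m i (f i).
    by apply: filterS => i fi; exists (f i) => m mn; exact: (fi (Ordinal mn)).
  apply: filter_forall => -[m mn] /=; apply/near_andP; split=> //.
  have [[phi cphi]|nphi] := pselect (exists phi, c phi = m); last first.
    by apply: nearW => i phi cphi; case: nphi; exists phi.
  have only_phi : (\forall i \near U, (G phi -> decides i (f i) phi) /\
      (D phi -> ~ decides i (f i) phi)).
    apply/near_andP; split.
      have [Gphi|nG] := pselect (G phi); last by apply: nearW => i /nG.
      have /fE : @sat _ (expansion A) v rho phi.
        by apply: Gv; split=> //=; rewrite cphi.
      exact: filterS.
    have [Dphi|nD] := pselect (D phi); last by apply: nearW => i /nD.
    have /not_near : ~ \forall i \near U, decides i (f i) phi.
      by rewrite fE; apply: Dv; split=> //=; rewrite cphi.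
    exact: filterS.
  by apply: filterS only_phi => i fi psi; rewrite -cphi => /cI ->.
exists (uclass U (fst \o f)).
  apply: filterS2 (urepr_uclass U (fst \o f)) (fC 0) => i /= -> [].
  exact.
exists (fun z => uclass U (fun i => (f i).2 z)); split=> phi hphi.
  by apply/decidesP; apply: filterS (fC (c phi)) =>
    i [_ /(_ _ erefl)[/(_ hphi) phif _]].
move=> /decidesP; apply: near_not.
by apply: filterS (fC (c phi)) => i [_ /(_ _ erefl)[_ /(_ hphi)]].
Qed.

Lemma omega_saturated_pos (N : istruct S) (V : set (World N)) :
  omega_saturated_in V -> pos_omega_saturated_in V.
Proof. by move=> satV A fA AV x G Gx; apply: (satV A fA AV x G set0 Gx). Qed.

Lemma ustruct_omega_saturated : omega_saturated M'.
Proof.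
move=> w; split; last first.
  exact: (@internal_omega_saturated (fun i => upset (urepr w i))).
apply: omega_saturated_pos.
rewrite (_ : [set w] =
  [set v : World M' | \forall i \near U, [set urepr w i] (urepr v i)]).
  exact: (@internal_omega_saturated (fun i => [set urepr w i])).
apply/seteqP; split=> [v ->|v vw /=]; first exact: nearW.
by rewrite -[v]ureprK -[w]ureprK; apply/uclassP.
Qed.

End Saturation.

Theorem theorem6p5 (S : signature) (HS : countable_signature S)
    (M : istruct S) :
  exists (M' : istruct S) (eps : World M -> World M') (eta : Dom M -> Dom M'),
    elementary_embedding eps eta /\ omega_saturated M'.
Proof.
have [U [UU ooU]] := ultraFilterLemma eventually_filter.
exists (ustruct M U), (fun w => uclass U (fun=> w)),
  (fun d => uclass U (fun=> d)).
by split; [exact: diagonal_elementary | exact: ustruct_omega_saturated].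
Qed.
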